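(* Let $r\geq 3$, $k\geq 1$, $t\geq 1$ be integers. If $r\in\{3,4\}$ then \[ n_0(k,r,t)\leq (2.5\,t)^{\frac{1}{r-1}}(k-t)+k, \] and if $r\geq 5$ then \[ n_0(k,r,t)\leq (2t)^{\frac{1}{r-1}}(k-t)+k. \] Equivalently: for every integer $n\geq (2.5t)^{1/(r-1)}(k-t)+k$ (when $r\in\{3,4\}$), respectively $n\geq (2t)^{1/(r-1)}(k-t)+k$ (when $r\geq 5$), every $r$-wise $t$-intersecting family $\mathcal{F}\subset\binom{[n]}{k}$ satisfies $|\mathcal{F}|\leq\binom{n-t}{k-t}$.
   Context: $[n]=\{1,\dots,n\}$ and $\binom{[n]}{k}$ is the set of $k$-element subsets of $[n]$. A family $\mathcal{F}$ of sets is $r$-wise $t$-intersecting if $|F_1\cap\dots\cap F_r|\geq t$ for all (not necessarily distinct) $F_1,\dots,F_r\in\mathcal{F}$. $n_0(k,r,t)$ denotes the minimal integer $n_0$ such that for all $n\geq n_0$ and all $r$-wise $t$-intersecting families $\mathcal{F}\subset\binom{[n]}{k}$ one has $|\mathcal{F}|\leq\binom{n-t}{k-t}$ (the size of the full $t$-star, i.e. of all $k$-subsets of $[n]$ containing a fixed $t$-set). *)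

(* Defs.v *)
From mathcomp Require Import all_boot all_order all_algebra.
From mathcomp Require Import all_classical all_reals all_analysis.

Set Implicit Arguments.
Unset Strict Implicit.
Unset Printing Implicit Defensive.

Import Order.TTheory GRing.Theory Num.Theory.

Definition uniform_family (n k : nat) (F : {set {set 'I_n}}) : Prop :=
  forall A : {set 'I_n}, A \in F -> #|A| = k.

(* The r members are given by an arbitrary map from 'I_r, so repetitions are
   allowed. *)
Definition rwise_intersecting (r t n : nat) (F : {set {set 'I_n}}) : Prop :=
  forall G : 'I_r -> {set 'I_n},
    (forall i, G i \in F) -> t <= #|\bigcap_(i < r) G i|.

(* If k < t or n < k, the truncated subtractions below are harmless: for
   1 <= r an r-wise t-intersecting k-uniform family on 'I_n then has no members
   at all when k < t, and no k-subset of 'I_n exists when n < k. *)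
Definition star_bound (n k r t : nat) : Prop :=
  forall F : {set {set 'I_n}},
    uniform_family k F -> rwise_intersecting r t F ->
    #|F| <= 'C(n - t, k - t).

Definition star_bound_from (k r t m : nat) : Prop :=
  forall n : nat, m <= n -> star_bound n k r t.

Definition is_n0 (k r t m : nat) : Prop :=
  star_bound_from k r t m /\
  forall m' : nat, star_bound_from k r t m' -> m <= m'.

Local Open Scope ring_scope.

(* The subtraction k - t is taken in R, hence is not truncated. *)
Definition threshold (R : realType) (c : R) (k r t : nat) : R :=
  (c * t%:R) `^ (1 / (r%:R - 1)) * (k%:R - t%:R) + k%:R.

(* n_0(k,r,t) <= x, for the natural number n_0(k,r,t) and a real x, is compared
   through the integers n >= x, i.e. it means n_0(k,r,t) <= max(0, ceil x); this
   is the reading under which it is equivalent to the bound on families holding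
   for every integer n >= x (x is not an integer in general, and may be negative
   when k < t). *)
Definition n0_at_most (R : realType) (k r t : nat) (x : R) : Prop :=
  exists m : nat, is_n0 k r t m /\ forall n : nat, x <= n%:R -> (m <= n)%N.

(* Main.v *)
(* Write s = k - t, m = n - k and u = (c t)^(-1/(r-1)), so that the threshold on n
   says s <= u m. Shifting reduces to shifted families F. A member of such a family,
   read as a walk with up-steps for its elements, must reach a line of slope r - 1,
   i.e. |A /\ [t + r i]| >= t + (r - 1) i for some i (Frankl).

   If some member does not contain [t], then any two members A, B containing [t]
   meet outside [t], so Erdos-Ko-Rado bounds the number of those by C(m+s-1, s-1),
   a fraction s / (m + s) of the star. Walks that reach the line without starting
   with t up-steps are counted by a supermartingale argument: walks from distance a
   are at most b^a C(m+s, s) whenever b >= 1 and u^(r-1) b^r <= (b - 1) (1+u)^(r-1),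
   hence the late ones are at most (b^t - 1) C(m+s, s). It remains to choose b with
   b^t - 1 <= 1 / (1 + u) <= m / (m + s). *)

Require Import Defs.
From mathcomp Require Import all_boot all_order all_algebra.
From mathcomp Require Import all_classical all_reals all_analysis.
From mathcomp Require Import fintype bigop finset zify ring lra.

Set Implicit Arguments.
Unset Strict Implicit.
Unset Printing Implicit Defensive.

Import Order.TTheory GRing.Theory Num.Theory.

(** * Shifting *)

Section Shifting.
Variable n : nat.
Implicit Types (A B D : {set 'I_n}) (F : {set {set 'I_n}}) (i j : 'I_n).

Definition swap (i j : 'I_n) A := i |: (A :\ j).

Definition shifted F := forall A i j,
  A \in F -> i < j -> j \in A -> i \notin A -> swap i j A \in F.

Definition movable F i j A : bool :=
  [&& j \in A, i \notin A & swap i j A \notin F].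

Definition shift_set F i j A := if movable F i j A then swap i j A else A.

Definition shift F i j := [set shift_set F i j A | A in F].

Lemma swapK i j A : j \in A -> i \notin A -> swap j i (swap i j A) = A.
Proof.
move=> jA iA; apply/setP=> x; rewrite !inE.
have [->|xj] := eqVneq x j; first by rewrite jA.
by have [->|xi] := eqVneq x i; rewrite ?(negPf iA).
Qed.

Lemma card_swap i j A : j \in A -> i \notin A -> #|swap i j A| = #|A|.
Proof.
move=> jA iA; rewrite /swap cardsU1 !inE (negPf iA) andbF /=.
by rewrite (cardsD1 j A) jA.
Qed.

(** A moved set lands outside [F], so it never coincides with an unmoved one, and [swapK] recovers a
    moved set from its image. *)
Lemma shift_set_inj F i j : {in F &, injective (shift_set F i j)}.
Proof.
move=> A B AF BF; rewrite /shift_set.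
case: ifPn => [/and3P[jA iA sA]|_]; case: ifPn => [/and3P[jB iB sB]|_] //.
- by move=> E; rewrite -(swapK jA iA) E swapK.
- by move=> E; rewrite E BF in sA.
- by move=> E; rewrite -E AF in sB.
Qed.

Lemma card_shift F i j : #|shift F i j| = #|F|.
Proof. by rewrite card_in_imset //; apply: shift_set_inj. Qed.

Lemma shift_uniform k F i j : uniform_family k F -> uniform_family k (shift F i j).
Proof.
move=> Fk _ /imsetP[A AF ->]; rewrite /shift_set.
case: ifPn => [/and3P[jA iA _]|_]; last exact: Fk.
by rewrite card_swap // Fk.
Qed.

(** The common part of the [G l] differs from that of their preimages [A l] at most in [i] and [j].
    A loss of [j] is either offset by a gain of [i] or avoided by comparing with other members of
    [F]. *)
Lemma shift_rwise r t F i j : i != j ->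
  rwise_intersecting r t F -> rwise_intersecting r t (shift F i j).
Proof.
move=> ij Ft G GF.
have /fin_all_exists[A HA] : forall l, exists A, A \in F /\ G l = shift_set F i j A.
  by move=> l; have /imsetP[A AF ->] := GF l; exists A.
have AF l : A l \in F by case: (HA l).
have GA l : G l = shift_set F i j (A l) by case: (HA l).
have out l x : x != i -> x != j -> (x \in G l) = (x \in A l).
  move=> xi xj; rewrite GA /shift_set; case: ifP => // _.
  by rewrite !inE (negPf xi) xj.
have [/existsP[l0 mv0]|/existsPn nomv] := boolP [exists l, movable F i j (A l)]; last first.
  apply: Ft => l; rewrite GA /shift_set (negPf (nomv l)); exact: AF.
have /and3P[jA0 iA0 _] := mv0.
have iNA : i \notin \bigcap_(l < r) A l.
  by apply/bigcapP => /(_ l0 isT); rewrite (negPf iA0).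
(* The common part of the [A l] lacks [i]; if every [G l] contains [i], this gain offsets the
   possible loss of [j]. *)
have [/existsP[l1 iG1]|/existsPn allG] := boolP [exists l, i \notin G l]; last first.
  rewrite (leq_trans (Ft A AF)) //.
  have sub : (\bigcap_(l < r) A l) :\ j \subset (\bigcap_(l < r) G l) :\ i.
    apply/subsetP=> x; rewrite !inE => /andP[xj /bigcapP xA].
    have xi : x != i by apply: contraNneq iNA => <-; apply/bigcapP.
    by rewrite xi /=; apply/bigcapP => l _; rewrite out // xA.
  have iG : i \in \bigcap_(l < r) G l.
    by apply/bigcapP => l _; have := allG l; rewrite negbK.
  rewrite (cardsD1 i (\bigcap_(l < r) G l)) iG (cardsD1 j (\bigcap_(l < r) A l)).
  by apply: leq_add; [case: (_ \in _) | apply: subset_leq_card].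
have nm1 : ~~ movable F i j (A l1).
  by apply: contra iG1 => mv1; rewrite GA /shift_set mv1 !inE eqxx.
have G1 : G l1 = A l1 by rewrite GA /shift_set (negPf nm1).
have [jA1|jA1] := boolP (j \in A l1); last first.
  rewrite (leq_trans (Ft A AF)) //; apply: subset_leq_card; apply/subsetP=> x xA.
  have xi : x != i by apply: contraNneq iNA => <-.
  have xj : x != j.
    by apply: contraNneq jA1 => <-; move/bigcapP: xA; apply.
  by apply/bigcapP=> l _; rewrite out //; move/bigcapP: xA; apply.
(* An unmoved set with [j] but without [i] is replaced by its swap, which is in [F] because the set
   did not move. Then [C l0] lacks [i], [C l1] lacks [j], and away from [i] and [j] the families [C]
   and [G] agree. *)
pose C l := if movable F i j (A l) then A l else
  if (j \in A l) && (i \notin A l) then swap i j (A l) else A l.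
have CF l : C l \in F.
  rewrite /C; case: ifPn => // nm; case: ifP => // /andP[jA iA].
  by move: nm; rewrite /movable jA iA /= negbK.
rewrite (leq_trans (Ft C CF)) //; apply: subset_leq_card; apply/subsetP=> x /bigcapP xC.
have xi : x != i.
  by apply: contraTneq (xC l0 isT) => ->; rewrite /C mv0.
have xj : x != j.
  apply: contraTneq (xC l1 isT) => ->; rewrite /C (negPf nm1) jA1.
  by rewrite -G1 iG1 !inE eqxx orbF eq_sym.
apply/bigcapP=> l _; rewrite out //; have := xC l isT.
rewrite /C; case: ifP => // _; case: ifP => // _.
by rewrite !inE (negPf xi) xj.
Qed.

(** Termination measure: every shift with [i < j] that changes the family lowers it. *)
Definition weight F := \sum_(A in F) \sum_(x in A) (x : nat).

Lemma shift_weight F A (i j : 'I_n) :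
    A \in F -> i < j -> j \in A -> i \notin A -> swap i j A \notin F ->
  weight (shift F i j) < weight F.
Proof.
move=> AF ij jA iA sA.
have swap_lt B : j \in B -> i \notin B ->
    \sum_(x in swap i j B) (x : nat) < \sum_(x in B) (x : nat).
  move=> jB iB; rewrite /swap big_setU1 /= ?(big_setD1 j jB) ?ltn_add2r //.
  by rewrite !inE (negPf iB) andbF.
rewrite /weight /shift big_imset /=; last exact: shift_set_inj.
rewrite (big_setD1 A AF) [ltnRHS](big_setD1 A AF) /= -addSn.
apply: leq_add; first by rewrite /shift_set /movable jA iA sA swap_lt.
apply: leq_sum => B _; rewrite /shift_set; case: ifP => // /and3P[jB iB _].
exact/ltnW/swap_lt.
Qed.

Lemma shifted_representative r t k F :
    uniform_family k F -> rwise_intersecting r t F ->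
  exists F' : {set {set 'I_n}}, [/\ uniform_family k F', rwise_intersecting r t F',
    shifted F' & #|F'| = #|F|].
Proof.
have [w] := ubnP (weight F); elim: w F => // w IH F ltw Fk Ft.
have [/existsP[A /existsP[i /existsP[j /and5P[AF ij jA iA sA]]]]|sh] := boolP
  [exists A, exists i : 'I_n, exists j : 'I_n,
     [&& A \in F, i < j, j \in A, i \notin A & swap i j A \notin F]]; last first.
  exists F; split=> // A i j AF ij jA iA; apply: contraNT sh => sA.
  apply/existsP; exists A; apply/existsP; exists i; apply/existsP; exists j.
  by rewrite AF ij jA iA.
have [|||F' [F'k F't F'sh cF']] := IH (shift F i j).
- by rewrite (leq_trans (shift_weight AF ij jA iA sA)).
- exact: shift_uniform.
- by apply: shift_rwise => //; rewrite neq_ltn ij.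
by exists F'; split=> //; rewrite cF' card_shift.
Qed.

End Shifting.

(** * Shifted families reach the line *)

Section Prefix.
Variable n : nat.
Implicit Types (A B D : {set 'I_n}) (F : {set {set 'I_n}}).

Definition prefix_card A p := #|[set x in A | x < p]|.

Lemma prefix_cardS A p (lt_pn : p < n) :
  prefix_card A p.+1 = (Ordinal lt_pn \in A) + prefix_card A p.
Proof.
rewrite /prefix_card (cardsD1 (Ordinal lt_pn)) !inE /= ltnSn andbT.
congr (_ + _); apply: eq_card => x; rewrite !inE -val_eqE /= ltnS.
by case: (x \in A); rewrite ?andbF //= [RHS]ltn_neqAle.
Qed.

Lemma prefix_card_id p A : p <= n -> (forall x : 'I_n, x < p -> x \in A) ->
  prefix_card A p = p.
Proof.
elim: p => [|p IHp] le_pn sA.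
  by apply: eq_card0 => x; rewrite !inE andbF.
rewrite (prefix_cardS _ le_pn) sA //= IHp //; first exact: ltnW.
by move=> x ltx; apply: sA; apply: ltnW.
Qed.

Lemma prefix_cardD p q A : p + q <= n -> prefix_card A (p + q) <= prefix_card A p + q.
Proof.
elim: q => [|q IHq]; first by rewrite !addn0.
rewrite !addnS => le_pqn; rewrite (prefix_cardS _ le_pqn).
by rewrite -add1n leq_add ?IHq ?leq_b1 // ltnW.
Qed.

Lemma prefix_card_swap A (i j : 'I_n) p : i < j -> j \in A -> i \notin A ->
  prefix_card (swap i j A) p = prefix_card A p + (i < p <= j).
Proof.
move=> ij jA iA; have nij : i != j by rewrite neq_ltn ij.
have E : [set x in swap i j A | x < p] =
    if i < p then i |: ([set x in A | x < p] :\ j) else [set x in A | x < p] :\ j.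
  apply/setP => x; case: (ltnP i p) => ip; rewrite !inE.
    by have [->|xi] := eqVneq x i; rewrite ?ip //= andbA.
  by have [->|xi] := eqVneq x i; rewrite /= ?(ltnNge i) ?ip ?andbF //= andbA.
rewrite /prefix_card E; have := cardsD1 j [set x in A | x < p].
rewrite inE jA /=; case: (ltnP i p) => ip.
  rewrite cardsU1 !inE (negPf iA) andbF /= => ->.
  by case: (ltnP j p) => jp /=; rewrite ?addn0 ?add0n addnC.
have -> : (j < p) = false by apply/negbTE; rewrite -leqNgt; apply: leq_trans ip (ltnW ij).
by rewrite add0n addn0.
Qed.

(* Replacing the least element of A \ D by a smaller element of D \ A keeps the
   prefix condition and lowers #|A \ D|. *)
Lemma shifted_subset F A D : shifted F -> A \in F ->
    (forall p, p <= n -> prefix_card A p <= prefix_card D p) ->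
  exists2 B, B \in F & B \subset D.
Proof.
move=> shF; have [N] := ubnP #|A :\: D|; elim: N A => // N IH A ltN AF dom.
have [AD|] := boolP (A \subset D); first by exists A.
case/subsetPn=> y0 y0A y0D.
have y0AD : y0 \in A :\: D by rewrite inE y0D.
case: (arg_minnP (fun x : 'I_n => x : nat) y0AD) => y /setDP[yA yD] ymin.
have AyD (x : 'I_n) : x \in A -> x < y -> x \in D.
  move=> xA xy; apply: contraLR xy => xD; rewrite -leqNgt; apply: ymin.
  by apply/setDP; split.
have [/existsP[x /and3P[xD xA xy]]|/existsPn nox] :=
    boolP [exists x : 'I_n, [&& x \in D, x \notin A & x < y]]; last first.
  (* Without such an [x], every element of [D] below [y] would be in [A], so [A] would have more
     elements than [D] below y + 1. *)
  have := dom y.+1 (ltn_ord y).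
  have Ey : Ordinal (ltn_ord y) = y by apply: val_inj.
  rewrite !(prefix_cardS _ (ltn_ord y)) Ey yA (negPf yD) ltnNge => /negP[].
  apply: subset_leq_card; apply/subsetP=> x; rewrite !inE => /andP[xD xy].
  by rewrite xy andbT; have := nox x; rewrite xD xy andbT negbK.
apply: (IH (swap x y A)).
- rewrite -ltnS; apply: leq_trans ltN; rewrite ltnS; apply: proper_card.
  apply/properP; split.
    apply/subsetP=> z; rewrite !inE => /andP[zD /orP[/eqP zx|/andP[_ ->]]].
      by rewrite zx xD in zD.
    by rewrite zD.
  exists y; rewrite !inE ?yA ?yD // eqxx orbF.
  by apply/negP=> /eqP E; rewrite E ltnn in xy.
- exact: shF.
move=> p le_pn; rewrite prefix_card_swap //.
have [/andP[xp py]|_] := boolP (x < p <= y); last by rewrite addn0 dom.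
rewrite addn1; apply: proper_card; apply/properP; split.
  apply/subsetP=> z; rewrite !inE => /andP[zA zp]; rewrite zp andbT.
  by apply: AyD => //; apply: leq_trans py.
by exists x; rewrite !inE ?xD ?(negPf xA).
Qed.

(* The sets D_j = [0, t - 1) together with the x such that x - (t - 1) is not
   j mod r, for j < r, have common part [0, t - 1); if A missed the line, each
   D_j would contain a member of F. *)
Lemma shifted_hits r t F A :
    2 <= r -> 0 < t -> rwise_intersecting r t F -> shifted F -> A \in F ->
  exists2 i : nat, t + r * i <= n & t + r.-1 * i <= prefix_card A (t + r * i).
Proof.
case: t => // t; move=> r2 _ Ft shF AF.
have [/existsP[i /andP[Hi1 Hi2]]|/existsPn nohit] := boolP [exists i : 'I_n.+1,
  (t.+1 + r * i <= n) && (t.+1 + r.-1 * i <= prefix_card A (t.+1 + r * i))].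
  by exists i.
have r0 : 0 < r by apply: leq_trans r2.
have miss (i : nat) : t.+1 + r * i <= n -> prefix_card A (t.+1 + r * i) <= t + r.-1 * i.
  move=> le_n; have lti : i < n.+1 by nia.
  by have := nohit (Ordinal lti); rewrite /= le_n /= -ltnNge.
pose D (j : 'I_r) : {set 'I_n} := [set x : 'I_n | (x < t) || ((x - t) %% r != j)].
have dom (j : 'I_r) p : p <= n -> prefix_card A p <= prefix_card (D j) p.
  move=> le_pn; have [le_pt|lt_tp] := leqP p t.
    rewrite [leqRHS]prefix_card_id //.
      have := @prefix_cardD 0 p A; rewrite add0n => /(_ le_pn); rewrite /prefix_card.
      by rewrite (_ : #|[set x in A | x < 0]| = 0) //; apply: eq_card0 => x;
         rewrite !inE andbF.
    by move=> x xp; rewrite inE (leq_trans xp le_pt).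
  (* With p = t + 1 + r i + l, missing the line leaves [A] at most t + (r - 1) i + l elements below
     p, while [D j] omits at most i + 1 points there, one per block of length r starting at t. Here
     [t] is one less than the intersection size. *)
  have Ep := divn_eq (p - t.+1) r; set i := (p - t.+1) %/ r in Ep.
  set l := (p - t.+1) %% r in Ep; have ltl : l < r by rewrite ltn_mod.
  have pE : p = t.+1 + r * i + l by rewrite -(subnKC lt_tp) Ep; lia.
  have le1 : prefix_card A p <= t + r.-1 * i + l.
    rewrite pE in le_pn *; apply: leq_trans (prefix_cardD _ _) _ => //.
    by rewrite leq_add2r miss //; lia.
  apply: leq_trans le1 _.
  have tot : prefix_card (D j) p + #|[set x : 'I_n | x < p] :\: D j| = p.
    rewrite -[RHS](@prefix_card_id p setT) //; last by move=> x; rewrite inE.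
    rewrite /prefix_card -[RHS](cardsID (D j)); congr (_ + _);
      apply: eq_card => x; rewrite !inE //.
    by rewrite andbC.
  have few : #|[set x : 'I_n | x < p] :\: D j| <= i.+1.
    rewrite -[leqRHS]card_ord.
    have inj : {in [set x : 'I_n | x < p] :\: D j &, injective
        (fun x : 'I_n => inord ((x - t) %/ r) : 'I_i.+1)}.
      have bnd (x : 'I_n) : x \in [set x : 'I_n | x < p] :\: D j ->
          [/\ t <= x, (x - t) %/ r < i.+1 & (x - t) %% r = j].
        rewrite !inE negb_or negbK -leqNgt => /andP[/andP[tx /eqP xj] xp]; split=> //.
        by rewrite ltn_divLR //; nia.
      move=> x y /bnd[tx dx mx] /bnd[ty dy my] /(congr1 val).
      rewrite /= !inordK // => E; apply: val_inj => /=.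
      have := divn_eq (x - t) r; rewrite E mx -my -divn_eq; lia.
    by rewrite -(card_in_imset inj); apply: max_card.
  nia.
have /fin_all_exists[B HB] : forall j, exists B, B \in F /\ B \subset D j.
  by move=> j; have [B BF BD] := shifted_subset shF AF (dom j); exists B.
have BF j : B j \in F by case: (HB j).
have := Ft B BF; rewrite ltnNge => /negP[].
rewrite -[leqRHS](card_ord t).
have sub (x : 'I_n) : x \in \bigcap_(j < r) B j -> x < t.
  move=> /bigcapP xB; have ltm : (x - t) %% r < r by rewrite ltn_mod.
  case: (HB (Ordinal ltm)) => _ /subsetP/(_ x (xB _ isT)).
  by rewrite inE /= eqxx orbF.
case: t sub {Ft miss nohit D dom HB} => [|t] sub.
  by rewrite eq_card0 // => x; apply/negbTE/negP => /sub.
have inj : {in \bigcap_(j < r) B j &, injective (fun x : 'I_n => inord x : 'I_t.+1)}.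
  by move=> x y /sub xt /sub yt /(congr1 val); rewrite /= !inordK // => /val_inj.
by rewrite -(card_in_imset inj); apply: max_card.
Qed.

End Prefix.

(** * The Erdos-Ko-Rado theorem for shifted families *)

Definition shifted_in n (D : {set 'I_n}) (G : {set {set 'I_n}}) :=
  forall A (i j : 'I_n), A \in G -> i < j -> j \in A -> i \notin A -> i \in D ->
    swap i j A \in G.

(** Induction on [#|D|]: deleting the largest point [y] splits [G] into the sets avoiding [y] and
    the link of [y]. Both stay shifted and intersecting, and Pascal's rule adds their bounds. *)
Lemma ekr_shifted n (D : {set 'I_n}) (G : {set {set 'I_n}}) K :
    K.+1.*2 <= #|D| ->
    (forall A, A \in G -> A \subset D /\ #|A| = K.+1) ->
    {in G &, forall A B, A :&: B != set0} ->
    shifted_in D G ->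
  #|G| <= 'C(#|D|.-1, K).
Proof.
have [N] := ubnP #|D|; elim: N D G K => // N IH D G K ltN leKD GD GI Gsh.
have [eqKD|ltKD] := leqP #|D| K.+1.*2.
  have {leKD eqKD} cD : #|D| = K.+1.*2 by apply/eqP; rewrite eqn_leq eqKD.
  (* An intersecting family contains no set together with its complement, hence at most half of the
     (K + 1)-subsets of [D]. *)
  pose H := [set D :\: A | A in G].
  have cH : #|H| = #|G|.
    rewrite card_in_imset // => A B /GD[AD _] /GD[BD _] E.
    have DK (C : {set 'I_n}) : C \subset D -> D :\: (D :\: C) = C.
      by move=> CD; rewrite setDDr setDv set0U; apply/setIidPr.
    by rewrite -(DK A) // E DK.
  have dGH : G :&: H = set0.
    apply/setP=> A; rewrite !inE; apply/negP => /andP[AG /imsetP[B BG E]].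
    have /negP[] := GI _ _ AG BG; apply/eqP/setP => x; rewrite E !inE.
    by case: (x \in B); rewrite ?andbF.
  have sub : G :|: H \subset [set A : {set 'I_n} | A \subset D & #|A| == K.+1].
    apply/subsetP=> A; rewrite !inE => /orP[/GD[-> ->]|/imsetP[B /GD[BD cB] ->]].
      by rewrite eqxx.
    rewrite subsetDl /= cardsD (setIidPr BD) cD cB; lia.
  have := subset_leq_card sub; rewrite cards_draws cardsU dGH cards0 subn0 cH cD.
  have -> : K.+1.*2 = (K.*2.+1).+1 by lia.
  rewrite binS /=; have -> : 'C(K.*2.+1, K.+1) = 'C(K.*2.+1, K).
    rewrite -[RHS]bin_sub; last by lia.
    by congr 'C(_, _); lia.
  lia.
have [y0 y0D] : exists y, y \in D by apply/set0Pn; rewrite -card_gt0; lia.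
case: (arg_maxnP (fun x : 'I_n => x : nat) y0D) => y yD0 ymax.
have {yD0} yD : y \in D by [].
pose D' := D :\ y; pose G0 := [set A in G | y \notin A].
pose G1 := [set A :\ y | A in [set A in G | y \in A]].
have cD : #|D| = #|D'|.+1 by rewrite (cardsD1 y) yD.
have ltDy x : x \in D -> x != y -> x < y.
  by move=> xD xy; rewrite ltn_neqAle xy; exact: (ymax x xD).
have cG : #|G| = #|G0| + #|G1|.
  rewrite -(cardsID [set A : {set 'I_n} | y \in A] G) addnC; congr (_ + _).
    by apply: eq_card => A; rewrite !inE andbC.
  rewrite card_in_imset; first by apply: eq_card => A; rewrite !inE.
  move=> A B; rewrite !inE => /andP[_ yA] /andP[_ yB] E.
  by rewrite -(setD1K yA) E setD1K.
have le0 : #|G0| <= 'C(#|D'|.-1, K).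
  apply: IH; try by lia.
  - move=> A; rewrite !inE => /andP[AG yA]; have [AD cA] := GD A AG; split=> //.
    by rewrite subsetD1 AD.
  - by move=> A B; rewrite !inE => /andP[AG _] /andP[BG _]; apply: GI.
  move=> A i j; rewrite !inE => /andP[AG yA] ij jA iA /andP[iy iD].
  by rewrite Gsh //= negb_or negb_and negbK yA orbT eq_sym iy.
have I1 : {in G1 &, forall A B, A :&: B != set0}.
  move=> _ _ /imsetP[A + ->] /imsetP[B + ->]; rewrite !inE.
  move=> /andP[AG yA] /andP[BG yB]; apply/negP => /eqP/setP dis.
  have [AD cA] := GD A AG; have [BD cB] := GD B BG.
  (* If [A] and [B] meet only in [y], their union has at most 2K + 1 points and misses some [x] in
     [D]. Replacing [y] by [x] in [A] then gives a member of [G] disjoint from [B]. *)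
  have /card_gt0P[x] : 0 < #|D :\: (A :|: B)|.
    have cAB : 0 < #|A :&: B| by apply/card_gt0P; exists y; rewrite inE yA.
    rewrite cardsD subn_gt0; apply: leq_ltn_trans (subset_leq_card (subsetIr _ _)) _.
    rewrite cardsU cA cB; lia.
  rewrite !inE negb_or => /andP[/andP[xA xB] xD].
  have xy : x != y by apply: contraNneq xA => ->.
  have /negP[] := GI _ _ (Gsh A x y AG (ltDy _ xD xy) yA xA xD) BG.
  apply/eqP/setP => z; have := dis z; rewrite !inE.
  have [->|zx] := eqVneq z x; first by rewrite (negPf xB).
  by case: (z != y).
have sh1 : shifted_in D' G1.
  move=> _ i j /imsetP[A + ->]; rewrite !inE => /andP[AG yA] ij /andP[jy jA].
  rewrite negb_and negbK => /orP[/eqP->|iA] /andP[iy iD]; first by rewrite eqxx in iy.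
  apply/imsetP; exists (swap i j A).
    by rewrite !inE Gsh //= yA andbT orbC eq_sym jy.
  apply/setP=> x; rewrite !inE; have [->|xi] := eqVneq x i; first by rewrite iy.
  by rewrite andbCA.
have D1 A : A \in G1 -> A \subset D' /\ #|A| = K.
  move: A => _ /imsetP[A + ->]; rewrite inE => /andP[AG yA]; have [AD cA] := GD A AG.
  by split; [apply: setSD | move: cA; rewrite (cardsD1 y A) yA => -[]].
(* For K = 0 the members of the link are empty, so an intersecting link has none. *)
case: K => [|K] in leKD GD ltKD le0 D1 *.
  have -> : #|G| = #|G0|.
    rewrite cG (_ : #|G1| = 0) ?addn0 //; apply: eq_card0 => A.
    apply/negP=> AG1; have /negP[] := I1 A A AG1 AG1.
    by rewrite setIid -cards_eq0 (D1 A AG1).2.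
  by rewrite !bin0 in le0 *.
have le1 : #|G1| <= 'C(#|D'|.-1, K) by apply: IH => //; lia.
rewrite cG cD /=; have -> : #|D'| = #|D'|.-1.+1 by lia.
by rewrite binS leq_add.
Qed.

(** * Counting walks *)

Fixpoint bit_words n : seq bitseq :=
  if n is n'.+1 then map (cons true) (bit_words n') ++ map (cons false) (bit_words n')
  else [:: [::]].

Lemma mem_bit_words w : w \in bit_words (size w).
Proof.
elim: w => [|[] w IHw] //=; rewrite mem_cat map_f ?orbT //.
Qed.

(* [hits r a w]: the walk w, true being a unit step towards the line and false a
   step of r - 1 units away from it, reaches the line when started at distance a. *)
Fixpoint hits r a (w : bitseq) : bool :=
  (a == 0) || match w with
    | [::] => false
    | true :: w' => hits r a.-1 w'
    | false :: w' => hits r (a + r.-1) w'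
    end.

Lemma hits_le r a w : hits r a w -> a <= count id w.
Proof.
elim: w a => [|[] w IHw] [|a] //= /IHw; rewrite ?add1n ?ltnS // add0n.
by apply: leq_trans; rewrite leq_addr.
Qed.

(** After [p] steps the walk is on or beyond the line; approaching by unit steps only, it cannot
    jump over it. *)
Lemma prefix_hits r a w p : p <= size w ->
    a + r.-1 * (p - count id (take p w)) <= count id (take p w) ->
  hits r a w.
Proof.
elim: w a p => [|b w IHw] [|a] [|p] //=; rewrite ?take0 //=.
  by rewrite ltnS => pw; case: b => /= H; apply: (IHw _ p) => //; move: H;
     have := count_size id (take p w); rewrite size_takel //; nia.
Qed.

Definition walks r a k := [pred w : bitseq | hits r a w & count id w == k].
Definition star_walks a k := [pred w : bitseq | all id (take a w) & count id w == k].

Lemma count_bit_words (P : pred bitseq) n :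
  count P (bit_words n.+1) =
  count (fun w => P (true :: w)) (bit_words n) + count (fun w => P (false :: w)) (bit_words n).
Proof. by rewrite /= count_cat !count_map. Qed.

Lemma count_ones n k : count (fun w => count id w == k) (bit_words n) = 'C(n, k).
Proof.
elim: n k => [|n IHn] k; first by case: k.
rewrite count_bit_words /=; case: k => [|k].
  by rewrite IHn !bin0 (eq_count (a2 := pred0)) ?count_pred0.
by rewrite binS -!IHn addnC; congr (_ + _); apply: eq_count.
Qed.

Lemma count_star_walks a m s :
  count (star_walks a (a + s)) (bit_words (a + (m + s))) = 'C(m + s, s).
Proof.
elim: a => [|a IHa].
  rewrite !add0n -count_ones; apply: eq_count => w /=.
  by rewrite take0.
rewrite addSn count_bit_words -IHa -[RHS]addn0; congr (_ + _).
by rewrite (eq_count (a2 := pred0)) // count_pred0.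
Qed.

Section WalkBound.
Variables (R : realFieldType) (r : nat) (u b : R).
Hypothesis b_ge1 : (1 <= b)%R.
Hypothesis r_ge2 : 2 <= r.
Hypothesis u_le1 : (u <= 1)%R.
Hypothesis step : forall m s, r.-1 <= s -> 0 < m -> (s%:R <= u * m%:R)%R ->
  (b ^+ r * ('C(m + s - r, s - r.-1))%:R <= (b - 1) * ('C(m + s, s))%:R)%R.

(** Split by the first step. A step towards the line leaves distance a with the same m and s. A step
    away leaves distance a + r with m - 1 and s - (r - 1). By [step] the two bounds add up to at
    most b^(a+1) C(m+s, s). *)
Lemma count_walks_le a m s : (s%:R <= u * m%:R)%R ->
  ((count (walks r a (a + s)%N) 
      (bit_words (a + (m + s))%N))%:R
     <= b ^+ a * ('C(m + s, s))%:R)%R.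
Proof.
have [n] := ubnP (a + (m + s)).
elim: n a m s => // n IHn [|a] m s ltn sum.
  rewrite !add0n expr0 mul1r -count_ones ler_nat.
  by apply/eq_leq/eq_count => w /=; case: w.
rewrite addSn count_bit_words natrD.
have lt : ((count (fun w => walks r a.+1 (a + s)%N.+1 (true :: w)) 
      (bit_words (a + (m + s))%N))%:R
    <= b ^+ a * ('C(m + s, s))%:R)%R.
  apply: le_trans (IHn a m s _ sum); last by lia.
  by rewrite ler_nat; apply/eq_leq/eq_count => w.
suff lf : ((count (fun w => walks r a.+1 (a + s)%N.+1 (false :: w)) 
      (bit_words (a + (m + s))%N))%:R
    <= b ^+ a * ((b - 1) * ('C(m + s, s))%:R))%R.
  apply: le_trans (lerD lt lf) _; rewrite exprS.
  by rewrite -mulrDr -{1}['C(_, _)%:R%R]mul1r -mulrDl addrC subrK mulrCA mulrA.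
have b0 : (0 <= b)%R by apply: le_trans b_ge1.
(* With s < r - 1 too few up-steps remain to reach the line after a first step away. *)
have [les|lts] := leqP r.-1 s; last first.
  rewrite (eq_count (a2 := pred0)) ?count_pred0.
    by rewrite mulr_ge0 ?exprn_ge0 // mulr_ge0 // subr_ge0.
  move=> w /=; apply/negbTE/negP => /andP[/hits_le le /eqP]; lia.
have m0 : 0 < m.
  rewrite lt0n; apply/negP => /eqP m0; move: sum; rewrite m0 mulr0 lern0 => /eqP s0.
  by rewrite s0 in les; lia.
apply: le_trans (ler_wpM2l (exprn_ge0 a b0) (step les m0 sum)).
rewrite mulrA -exprD.
have -> : 'C(m + s - r, s - r.-1) = 'C(m.-1 + (s - r.-1), s - r.-1) by congr 'C(_, _); lia.
apply: le_trans (IHn (a + r) m.-1 (s - r.-1) _ _).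
- have -> : a + r + (m.-1 + (s - r.-1)) = a + (m + s) by lia.
  rewrite ler_nat; apply/eq_leq/eq_count => w /=.
  have -> : a.+1 + r.-1 = a + r by lia.
  by have -> : a + r + (s - r.-1) = (a + s).+1 by lia.
- by lia.
(* The constraint s <= u m survives, since s drops by r - 1 >= 1 >= u. *)
rewrite natrB // -[m.-1]subn1 (natrB _ m0) mulrBr mulr1.
apply: lerB => //; apply: le_trans u_le1 _; rewrite ler1n; lia.
Qed.

(** Walks starting with [a] up-steps all reach the line, and there are C(m+s, s) of them to
    subtract. *)
Lemma count_late_walks_le a m s : (s%:R <= u * m%:R)%R ->
  ((count (fun w => [&& hits r a w, count id w == (a + s)%N & ~~ all id (take a w)]) 
      (bit_words (a + (m + s))%N))%:R
     <= (b ^+ a - 1) * ('C(m + s, s))%:R)%R.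
Proof.
move=> sum; have := count_walks_le a sum; rewrite mulrBl mul1r lerBrDr -natrD.
apply: le_trans; rewrite ler_nat -(count_star_walks a m s).
rewrite -count_predUI addnC (eq_count (a2 := pred0)) ?count_pred0 ?add0n.
  apply: sub_count => w /= /orP[/and3P[-> -> _]//|/andP[aw /eqP cw]].
  rewrite cw eqxx andbT; have : a <= size w.
    by rewrite (leq_trans (leq_addr s a)) // -cw count_size.
  elim: a w {sum cw} aw => [|a IHa] [|[] w] //= aw; exact: IHa.
by move=> w /=; case: (all id (take a w)); rewrite ?andbF.
Qed.

End WalkBound.

(** * From walks to families *)

Definition word n (A : {set 'I_n}) : bitseq := [seq i \in A | i <- enum 'I_n].

Lemma size_word n (A : {set 'I_n}) : size (word A) = n.
Proof. by rewrite size_map size_enum_ord. Qed.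

Lemma word_inj n : injective (@word n).
Proof.
move=> A B /eq_in_map E; apply/setP => x; apply: E; exact: mem_enum.
Qed.

Lemma count_take_word n (A : {set 'I_n}) p : p <= n ->
  count id (take p (word A)) = prefix_card A p.
Proof.
elim: p => [|p IHp] le_pn.
  by rewrite take0; symmetry; apply: eq_card0 => x; rewrite !inE andbF.
rewrite (prefix_cardS _ le_pn) -IHp 1?ltnW // (take_nth false) ?size_word //.
rewrite -cats1 count_cat addnC /= addn0; congr (_ + _).
rewrite (nth_map (Ordinal le_pn)) ?size_enum_ord //.
by rewrite (nth_ord_enum (Ordinal le_pn) (Ordinal le_pn)).
Qed.

Lemma count_word n (A : {set 'I_n}) : count id (word A) = #|A|.
Proof.
rewrite -[word A](take_size) size_word count_take_word //.
by apply: eq_card => x; rewrite !inE ltn_ord andbT.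
Qed.

Definition initial n t : {set 'I_n} := [set x : 'I_n | x < t].

Lemma card_initial n t : t <= n -> #|initial n t| = t.
Proof.
move=> le_tn; rewrite -[RHS](@prefix_card_id n t (initial n t)) //.
  by apply: eq_card => x; rewrite !inE andbb.
by move=> x; rewrite inE.
Qed.

Lemma all_take_word n t (A : {set 'I_n}) :
  all id (take t (word A)) -> initial n t \subset A.
Proof.
rewrite /word -map_take all_map => /allP H.
apply/subsetP=> x; rewrite inE => xt; apply: H.
by rewrite in_take ?mem_enum // index_enum_ord.
Qed.

Lemma rwise_ge3 n r t (F : {set {set 'I_n}}) A B C : 2 < r ->
  rwise_intersecting r t F -> A \in F -> B \in F -> C \in F -> t <= #|A :&: B :&: C|.
Proof.
case: r => [|[|[|r]]] // _ Ft AF BF CF.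
have := Ft (fun i : 'I_r.+3 => if i == ord0 then A else if i == 1%R then B else C).
move=> /(_ _)/leq_trans; apply.
  by move=> i; case: ifP => // _; case: ifP.
apply: subset_leq_card; apply/subsetP=> x /bigcapP xG.
have xA := xG ord0 isT; have xB := xG 1%R isT; have xC := xG (inord 2) isT.
move: xA xB xC; rewrite !inE /= => -> ->.
by rewrite -!val_eqE /= inordK.
Qed.

Lemma card_late r t k n (F : {set {set 'I_n}}) :
    1 < r -> 0 < t -> uniform_family k F -> rwise_intersecting r t F -> shifted F ->
  #|[set A in F | ~~ (initial n t \subset A)]| <=
  count (fun w => [&& hits r t w, count id w == k & ~~ all id (take t w)]) (bit_words n).
Proof.
move=> r2 t0 Fk Ft shF; set L := [set A in F | _].
rewrite cardE -(size_map (@word n)) -size_filter; apply: uniq_leq_size.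
  by rewrite map_inj_uniq ?enum_uniq //; apply: word_inj.
move=> w /mapP[A]; rewrite mem_enum inE => /andP[AF nA] ->.
rewrite mem_filter count_word Fk // eqxx /=.
rewrite (contraNN (@all_take_word n t A) nA) andbT.
have := mem_bit_words (word A); rewrite size_word => ->; rewrite andbT.
have [i le_n Hi] := shifted_hits r2 t0 Ft shF AF.
by apply: (@prefix_hits _ _ _ (t + r * i)); rewrite ?size_word // count_take_word //; nia.
Qed.

Lemma card_star_le t k n (F : {set {set 'I_n}}) :
    t <= n -> uniform_family k F -> (forall A, A \in F -> initial n t \subset A) ->
  #|F| <= 'C(n - t, k - t).
Proof.
move=> le_tn Fk Fi.
have cC : #|~: initial n t| = n - t by rewrite cardsCs setCK card_initial // card_ord.
have inj : {in F &, injective (fun A => A :\: initial n t)}.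
  move=> A B /Fi/setIidPr EA /Fi/setIidPr EB E.
  by rewrite -(setID A (initial n t)) -(setID B (initial n t)) E EA EB.
rewrite -(card_in_imset inj) -cC -cards_draws; apply: subset_leq_card.
apply/subsetP=> _ /imsetP[A AF ->]; rewrite inE setDE subsetIr /= -setDE.
by rewrite cardsD (setIidPr (Fi A AF)) card_initial // Fk.
Qed.

(** [A0] misses a point of [t]. If [A] and [B] met only inside [t], then [A], [B] and [A0] would
    share fewer than t points. So the traces outside [t] intersect, and they remain shifted
    there. *)
Lemma link_ekr r t m s n (F : {set {set 'I_n}}) A0 :
    2 < r -> 0 < s -> s <= m -> n = t + (m + s) ->
    uniform_family (t + s) F -> rwise_intersecting r t F -> shifted F ->
    A0 \in F -> ~~ (initial n t \subset A0) ->
  #|[set A in F | initial n t \subset A]| <= 'C((m + s).-1, s.-1).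
Proof.
move=> r3 s0 le_sm nE Fk Ft shF A0F /subsetPn[x0]; rewrite inE => x0t x0A0.
have le_tn : t <= n by lia.
have cC : #|~: initial n t| = m + s.
  by rewrite cardsCs setCK card_initial // card_ord nE addKn.
set I := initial n t in cC *; set F0 := [set A in F | _].
have inj : {in F0 &, injective (fun A => A :\: I)}.
  move=> A B; rewrite !inE => /andP[_ /setIidPr EA] /andP[_ /setIidPr EB] E.
  by rewrite -(setID A I) -(setID B I) E EA EB.
rewrite -(card_in_imset inj) -cC; apply: ekr_shifted.
- by rewrite cC; lia.
- move=> _ /imsetP[A + ->]; rewrite inE => /andP[AF IA]; split.
    by rewrite setDE subsetIr.
  by rewrite cardsD (setIidPr IA) card_initial // Fk // addKn; lia.
- move=> _ _ /imsetP[A + ->] /imsetP[B + ->]; rewrite !inE => /andP[AF IA] /andP[BF IB].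
  apply/negP=> /eqP/setP dis; have := rwise_ge3 r3 Ft A0F AF BF.
  rewrite leqNgt => /negP[]; rewrite -[ltnRHS](card_initial le_tn).
  apply: proper_card; apply/properP; split.
    apply/subsetP=> x; rewrite in_setI in_setI => /andP[/andP[_ xA] xB].
    by have := dis x; rewrite in_setI !in_setD xA xB in_set0 !andbT andbb => /negbFE.
  by exists x0; rewrite !inE // (negPf x0A0).
move=> _ i j /imsetP[A + ->]; rewrite !inE => /andP[AF IA] ij /andP[jt jA].
rewrite negb_and negbK => + it; rewrite (negPf it) /= => iA.
apply/imsetP; exists (swap i j A).
  rewrite inE shF //=; apply/subsetP=> x; rewrite !inE => xt.
  have /= xA := subsetP IA x; rewrite xA ?inE // andbT orbC.
  by apply/orP; left; apply: contraNneq jt => <-.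
apply/setP=> x; rewrite !inE; have [->|xi] /= := eqVneq x i; first by rewrite it.
by rewrite andbCA.
Qed.

Lemma star_bound_diag n r t : 2 < r -> star_bound n t r t.
Proof.
move=> r3 F Fk Ft; rewrite subnn bin0; apply/card_le1_eqP => A B AF BF.
have := rwise_ge3 r3 Ft AF AF BF; rewrite setIid => le_t.
have EA : A :&: B = A by apply/eqP; rewrite eqEcard subsetIl Fk.
have EB : A :&: B = B by apply/eqP; rewrite eqEcard subsetIr Fk.
by rewrite -EA EB.
Qed.

Lemma star_bound_small n k r t : 0 < r -> k < t -> star_bound n k r t.
Proof.
move=> r0 ltkt F Fk Ft; rewrite [#|F|](_ : _ = 0) //; apply: eq_card0 => A.
apply/negP=> AF; have := Ft (fun=> A) (fun=> AF); rewrite leqNgt => /negP[].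
apply: leq_ltn_trans ltkt; rewrite -(Fk A AF); apply: subset_leq_card.
by apply/subsetP=> x /bigcapP/(_ (Ordinal r0) isT).
Qed.

Lemma star_bound_rate (R : realFieldType) (r t m s : nat) (u b : R) :
    2 < r -> 0 < t -> 0 < s -> (1 <= b)%R -> (u <= 1)%R -> (s%:R <= u * m%:R)%R ->
    (forall m' s', r.-1 <= s' -> 0 < m' -> (s'%:R <= u * m'%:R)%R ->
      (b ^+ r * ('C(m' + s' - r, s' - r.-1))%:R <= (b - 1) * ('C(m' + s', s'))%:R)%R) ->
    ((b ^+ t - 1) * (m + s)%:R <= m%:R)%R ->
  star_bound (t + (m + s)) (t + s) r t.
Proof.
move=> r3 t0 s0 b1 u1 sum step bt F1 F1k F1t.
have [F [Fk Ft shF <-]] := shifted_representative F1k F1t.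
have [/forall_inP star|] :=
    boolP [forall (A | A \in F), initial (t + (m + s)) t \subset A].
  by apply: card_star_le => //; rewrite leq_addr.
case/forall_inPn => A0 A0F nA0.
have le_sm : s <= m.
  by rewrite -(ler_nat R) (le_trans sum) // ler_piMl.
rewrite !addKn.
rewrite -(cardsID [set A : {set 'I_(t + (m + s))} | initial (t + (m + s)) t \subset A] F).
have /= le0 := link_ekr r3 s0 le_sm erefl Fk Ft shF A0F nA0.
have le1 := card_late (ltnW r3) t0 Fk Ft shF.
have le2 := count_late_walks_le b1 (ltnW r3) u1 step t sum.
rewrite (_ : F :&: _ = [set A in F | initial (t + (m + s)) t \subset A]); last first.
  by apply/setP=> A; rewrite !inE.
rewrite (_ : F :\: _ = [set A in F | ~~ (initial (t + (m + s)) t \subset A)]); last first.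
  by apply/setP=> A; rewrite !inE andbC.
rewrite -(ler_nat R) natrD.
have {le1 le2} le1 := le_trans (eq_ind_r is_true le1 (ler_nat R _ _)) le2.
have N0 : (0 < (m + s)%:R :> R)%R by rewrite ltr0n addn_gt0 s0 orbT.
(* After multiplication by m + s, the members containing [t] account for at most s C(m+s, s) and the
   late ones for at most m C(m+s, s). *)
rewrite -(ler_pM2r N0).
apply: le_trans (_ : 'C(m + s, s)%:R * (s%:R + m%:R) <= _)%R; last first.
  by rewrite natrD addrC.
rewrite mulrDl mulrDr lerD //.
  have := mul_bin_diag (m + s) s.-1; rewrite prednK // => E.
  by rewrite -!natrM ler_nat [leqRHS]mulnC -E mulnC leq_mul2l le0 orbT.
apply: le_trans (ler_wpM2r (ltW N0) le1) _.
by rewrite mulrAC mulrC ler_wpM2l.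
Qed.

Local Open Scope ring_scope.

(** * Choice of the rate b *)

Section Rates.
Variable R : realFieldType.
Implicit Types (u b x y q : R).

(** The quotient of the binomials is the product of (s - i) / (N - i) over i < j, and q <= 1 keeps
    every factor at most q. *)
Lemma bin_ratio q j N s : (j <= s)%N -> (s <= N)%N -> s%:R <= q * N%:R -> q <= 1 ->
  ('C(N - j, s - j))%:R <= q ^+ j * ('C(N, s))%:R.
Proof.
elim: j N s => [|j IHj] N s; first by rewrite !subn0 expr0 mul1r.
case: s => // s; case: N => // N; rewrite !ltnS !subSS => js sN sq q1.
have q0 : 0 <= q by rewrite -(pmulr_lge0 _ (ltr0Sn R N)) (le_trans _ sq).
apply: le_trans (IHj N s js sN _ q1) _.
  by move: sq; rewrite -!natr1 mulrDr mulr1 => sq; lra.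
rewrite exprSr -mulrA ler_wpM2l ?exprn_ge0 //.
have N0 : 0 < N.+1%:R :> R by rewrite ltr0n.
have s0 : 0 < s.+1%:R :> R by rewrite ltr0n.
have := mul_bin_diag N.+1 s => /= /(congr1 (fun k => k%:R : R)); rewrite !natrM => E.
rewrite -(ler_pM2l N0) E mulrA ler_wpM2r // mulrC //.
Qed.

(** Since s / (m + s) <= u / (1 + u), the r - 1 up-steps cost a factor (u / (1 + u))^(r-1) by
    [bin_ratio]; the single down-step is only estimated by monotonicity in the upper index. *)
Lemma step_bound u b r m s : 0 <= u -> u <= 1 -> (1 < r)%N ->
    u ^+ r.-1 * b ^+ r <= (b - 1) * (1 + u) ^+ r.-1 -> 0 <= b ->
    (r.-1 <= s)%N -> (0 < m)%N -> s%:R <= u * m%:R ->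
  b ^+ r * ('C(m + s - r, s - r.-1))%:R <= (b - 1) * ('C(m + s, s))%:R.
Proof.
move=> u0 u1 r1 Hb b0 rs m0 sum.
have u1_gt0 : 0 < 1 + u by lra.
have le1 : ('C(m + s - r, s - r.-1))%:R <= ('C(m + s - r.-1, s - r.-1))%:R :> R.
  have -> : (m + s - r.-1 = (m + s - r).+1)%N by lia.
  rewrite ler_nat; case: (s - r.-1)%N => [|k]; first by rewrite !bin0.
  by rewrite binS leq_addr.
have le2 : ('C(m + s - r.-1, s - r.-1))%:R <= (u / (1 + u)) ^+ r.-1 * ('C(m + s, s))%:R.
  apply: bin_ratio => //; first exact: leq_addl.
    by rewrite mulrAC ler_pdivlMr // natrD; lra.
  by rewrite ler_pdivrMr // mul1r; lra.
apply: le_trans (ler_wpM2l (exprn_ge0 r b0) (le_trans le1 le2)) _.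
rewrite mulrA ler_wpM2r // expr_div_n mulrA ler_pdivrMr ?exprn_gt0 //.
by rewrite mulrC.
Qed.

(** Division-free form of (1 + 2y)^j <= (1 + jy) / (1 - jy), a discrete counterpart of e^(2x) <= (1
    + x) / (1 - x). *)
Lemma pow_one_plus y t j : 0 <= y -> (j <= t)%N -> t%:R * y <= 1 ->
  (1 + 2 * y) ^+ j * (1 - j%:R * y) <= 1 + j%:R * y.
Proof.
move=> y0; elim: j => [|j IHj] jt ty; first by rewrite expr0 mul0r subr0 addr0 mulr1.
have /IHj IH : (j <= t)%N by apply: ltnW.
have {}IH := IH ty.
have jy : j.+1%:R * y <= 1.
  by apply: le_trans ty; rewrite ler_wpM2r // ler_nat.
have [->|yn0] := eqVneq y 0; first by rewrite !mulr0 addr0 expr1n subr0 mulr1.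
have yp : 0 < y by rewrite lt_neqAle eq_sym yn0.
move: jy; rewrite -natr1; set J : R := j%:R => jy.
have J0 : 0 <= J by [].
have pos : 0 < 1 - J * y by lra.
rewrite -(ler_pM2r pos) exprS.
have H : (1 + 2 * y) * (1 - (J + 1) * y) * ((1 + 2 * y) ^+ j * (1 - J * y)) <=
    (1 + 2 * y) * (1 - (J + 1) * y) * (1 + J * y).
  by rewrite ler_wpM2l // mulr_ge0 //; lra.
apply: (le_trans (le_trans (_ : _ <= _) H)).
  by rewrite le_eqVlt; apply/orP; left; apply/eqP; ring.
have : 0 <= J * y * (y * y) by rewrite !mulr_ge0.
have : 0 <= J * (J * y * (y * y)) by rewrite !mulr_ge0.
have : 0 <= y * y by rewrite mulr_ge0.
nra.
Qed.

Definition good_rate r t u b := [/\ 1 <= b,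
  u ^+ r.-1 * b ^+ r <= (b - 1) * (1 + u) ^+ r.-1 & (b ^+ t - 1) * (1 + u) <= 1].

(* 2 / (3 + 2 u) is a rational lower bound of ln (1 + 1 / (1 + u)), whence
   b ^ t <= 1 + 1 / (1 + u). *)
Lemma good_rate_large (c u : R) a t : 0 <= u -> (0 < t)%N ->
    u ^+ a * (c * t%:R) = 1 ->
    (1 + 2 / (t%:R * (3 + 2 * u))) ^+ a.+1 <= 2 * c / (3 + 2 * u) * (1 + u) ^+ a ->
  good_rate a.+1 t u (1 + 2 / (t%:R * (3 + 2 * u))).
Proof.
move=> u0 t0 ua H; have T0 : 0 < t%:R :> R by rewrite ltr0n.
have v0 : 0 < 3 + 2 * u by lra.
have Tv0 : 0 < t%:R * (3 + 2 * u) by rewrite mulr_gt0.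
split => /=.
- by rewrite lerDl divr_ge0 // ltW.
(* Since u^a c t = 1, the factor u^a turns 2c / (3 + 2u) into b - 1. *)
- apply: le_trans (ler_wpM2l (exprn_ge0 a u0) H) _.
  rewrite [1 + _ - 1]addrC addKr mulrA ler_wpM2r ?exprn_ge0 //; first by lra.
  have -> : 2 / (t%:R * (3 + 2 * u)) = u ^+ a * (c * t%:R) * (2 / (t%:R * (3 + 2 * u))).
    by rewrite ua mul1r.
  rewrite le_eqVlt; apply/orP; left; apply/eqP; field.
  by rewrite !gt_eqF.
(* Here y = (b - 1) / 2 and ty = 1 / (3 + 2u), so (1 + ty) / (1 - ty) is exactly 1 + 1 / (1 + u). *)
set y := (t%:R * (3 + 2 * u))^-1.
have y0 : 0 <= y by rewrite invr_ge0 ltW.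
have Ey : t%:R * y * (3 + 2 * u) = 1 by rewrite /y; field; rewrite !gt_eqF.
have ty0 : 0 <= t%:R * y by rewrite mulr_ge0 // ltW.
have ty1 : t%:R * y <= 1 by nra.
have := pow_one_plus y0 (leqnn t) ty1.
set P := (_ ^+ t); set z := t%:R * y in Ey ty0 ty1 *.
have -> : z = (3 + 2 * u)^-1 by apply: (mulIf (lt0r_neq0 v0)); rewrite Ey mulVf ?gt_eqF.
move=> HP; have := ler_wpM2r (ltW v0) HP.
have -> : P * (1 - (3 + 2 * u)^-1) * (3 + 2 * u) = 2 * (P * (1 + u)).
  by field; rewrite gt_eqF.
have -> : (1 + (3 + 2 * u)^-1) * (3 + 2 * u) = 4 + 2 * u by field; rewrite gt_eqF.
move: (P * _) (mulrBl (1 + u) P 1) => w ->; lra.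
Qed.

(** For t = 1 the last clause allows b = 1 + 1 / (1 + u). The middle one then reads (u (2 + u) / (1
    + u)^2)^a (2 + u) <= 1, and [g] bounds the base. *)
Lemma good_rate_one a u g : 0 <= u -> 0 <= g ->
    u * (2 + u) <= g * (1 + u) ^+ 2 -> g ^+ a * (2 + u) <= 1 ->
  good_rate a.+1 1 u (1 + (1 + u)^-1).
Proof.
move=> u0 g0 Hg Ha; have v0 : 0 < 1 + u by lra.
have w0 : 0 < 2 + u by lra.
have -> : 1 + (1 + u)^-1 = (2 + u) / (1 + u) by field; rewrite gt_eqF.
split => /=.
- by rewrite ler_pdivlMr //; lra.
- have -> : (2 + u) / (1 + u) - 1 = (1 + u)^-1 by field; rewrite gt_eqF.
  rewrite expr_div_n mulrA ler_pdivrMr ?exprn_gt0 //.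
  have -> : (1 + u)^-1 * (1 + u) ^+ a * (1 + u) ^+ a.+1 = ((1 + u) ^+ 2) ^+ a.
    by rewrite exprAC expr2 exprS; field; rewrite gt_eqF.
  rewrite exprSr mulrA -exprMn.
  have le1 : (u * (2 + u)) ^+ a <= (g * (1 + u) ^+ 2) ^+ a.
    by apply: lerXn2r => //; rewrite nnegrE mulr_ge0 ?exprn_ge0 // ltW.
  apply: le_trans (ler_wpM2r (ltW w0) le1) _.
  by rewrite exprMn mulrAC ler_piMl // !exprn_ge0 // ltW.
- rewrite expr1 mulrBl mul1r divfK ?gt_eqF //; lra.
Qed.

Lemma rate_le t u : 0 <= u -> (2 <= t)%N ->
  (1 + 2 / (t%:R * (3 + 2 * u))) * (3 + 2 * u) <= 4 + 2 * u.
Proof.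
move=> u0 t2; have T2 : 2 <= t%:R :> R by rewrite ler_nat.
have T0 : 0 < t%:R :> R by lra.
have v0 : 0 < 3 + 2 * u by lra.
rewrite mulrDl mul1r; have -> : 2 / (t%:R * (3 + 2 * u)) * (3 + 2 * u) = 2 / t%:R.
  by field; rewrite !gt_eqF.
have : 2 / t%:R <= 1 :> R by rewrite ler_pdivrMr ?mul1r.
lra.
Qed.

Lemma good_rate_r5 a t u : (4 <= a)%N -> (2 <= t)%N -> 0 < u ->
    u ^+ a * (2 * t%:R) = 1 ->
  good_rate a.+1 t u (1 + 2 / (t%:R * (3 + 2 * u))).
Proof.
move=> a4 t2 u0 ua; apply: (good_rate_large (c := 2)) ; rewrite ?(ltW u0) //; first by lia.
have T2 : 2 <= t%:R :> R by rewrite ler_nat.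
have T0 : 0 < t%:R :> R by lra.
have v0 : 0 < 3 + 2 * u by lra.
have Tv0 : 0 < t%:R * (3 + 2 * u) by rewrite mulr_gt0.
have u1 : u <= 1.
  rewrite leNgt; apply/negP => lt.
  have : 1 < u ^+ a by rewrite exprn_egt1 //; lia.
  by move: ua; move: (u ^+ a) => z; nra.
(* This gives 4 <= tu (3 + 2u), that is, b <= 1 + u/2. It follows from 2 (tu)^a = t^(a-1) >= 2^(a-1)
   and (3/2)^4 > 4. *)
have tu : 4 / 3 <= t%:R * u.
  rewrite leNgt; apply/negP => lt.
  have lta : (t%:R * u) ^+ a < (4 / 3) ^+ a.
    by rewrite ltrXn2r ?mulr_ge0 ?(ltW u0) //; lia.
  have : 2 ^+ a <= (4 / 3) ^+ a * 4 :> R.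
    have E : (t%:R * u) ^+ a * 2 = t%:R ^+ a.-1.
      transitivity (t%:R ^+ a.-1 * (u ^+ a * (2 * t%:R))); last by rewrite ua mulr1.
      rewrite exprMn; have -> : t%:R ^+ a = t%:R ^+ a.-1 * t%:R :> R.
        by rewrite -exprSr prednK //; lia.
      by ring.
    have le2 : 2 ^+ a.-1 <= t%:R ^+ a.-1 :> R by apply: lerXn2r; rewrite ?nnegrE // ltW.
    have : 2 ^+ a = 2 ^+ a.-1 * 2 :> R by rewrite -exprSr; congr (_ ^+ _); lia.
    by move: E le2 lta; lra.
  have -> : a = (4 + (a - 4))%N by rewrite subnKC.
  rewrite !exprD; set A := 2 ^+ (a - 4); set B := (4 / 3) ^+ (a - 4).
  have A0 : 0 < A by rewrite exprn_gt0.
  have BA : B <= A by apply: lerXn2r; rewrite ?nnegrE //; lra.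
  lra.
set b := 1 + _; have b0 : 0 <= b by rewrite addr_ge0 // divr_ge0 // ltW.
have b1 : b <= 1 + u / 2.
  by rewrite /b lerD2l ler_pdivrMr //; nra.
have b2 : b * (3 + 2 * u) <= 4 + 2 * u by exact: rate_le (ltW u0) t2.
have w0 : 0 <= 1 + u / 2 by lra.
(* As 4 + 2u = 4 (1 + u/2), this is what remains after [b1] and [b2]. The case a = 4 is expanded;
   each further factor 1 + u/2 is at most 1 + u. *)
have Hpow : (1 + u / 2) ^+ a * (1 + u / 2) <= (1 + u) ^+ a.
  have -> : a = (4 + (a - 4))%N by rewrite subnKC.
  rewrite !exprD mulrAC; apply: ler_pM.
  - by rewrite mulr_ge0 ?exprn_ge0.
  - exact: exprn_ge0.
  - have u2 : 0 <= u ^+ 2 by rewrite exprn_ge0 ?ltW.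
    have u3 : 0 <= u ^+ 3 by rewrite exprn_ge0 ?ltW.
    have u4 : 0 <= u ^+ 4 by rewrite exprn_ge0 ?ltW.
    have u5 : 0 <= u ^+ 4 * (1 - u) by rewrite mulr_ge0 // subr_ge0.
    rewrite -subr_ge0 (_ : _ - _ = 3 / 2 * u + 7 / 2 * u ^+ 2 + 11 / 4 * u ^+ 3 +
      21 / 32 * u ^+ 4 + 1 / 32 * (u ^+ 4 * (1 - u))); first by lra.
    by field.
  - by apply: lerXn2r; rewrite ?nnegrE //; lra.
rewrite exprSr [X in _ <= X]mulrAC ler_pdivlMr // -mulrA.
apply: le_trans (_ : (1 + u / 2) ^+ a * (4 + 2 * u) <= _).
  apply: ler_pM b2 => //; rewrite ?exprn_ge0 ?mulr_ge0 ?(ltW v0) //.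
  by apply: lerXn2r; rewrite ?nnegrE.
by move: Hpow; lra.
Qed.

Lemma good_rate_r3 t u : (2 <= t)%N -> 0 < u -> u ^+ 2 * (5 / 2 * t%:R) = 1 ->
  good_rate 3 t u (1 + 2 / (t%:R * (3 + 2 * u))).
Proof.
move=> t2 u0 ua; apply: (good_rate_large (c := 5 / 2)) ; rewrite ?(ltW u0) //; first by lia.
have T2 : 2 <= t%:R :> R by rewrite ler_nat.
have T0 : 0 < t%:R :> R by lra.
have v0 : 0 < 3 + 2 * u by lra.
have Tv0 : 0 < t%:R * (3 + 2 * u) by rewrite mulr_gt0.
(* After b <= 1 + u and b (3 + 2u) <= 4 + 2u, what remains is 4 + 2u <= 5. *)
have u12 : u <= 1 / 2.
  rewrite leNgt; apply/negP => lt.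
  have : 1 / 4 < u ^+ 2 by rewrite expr2; nra.
  by move: ua; move: (u ^+ 2) => z; nra.
have tu : 2 / 3 <= t%:R * u.
  rewrite leNgt; apply/negP => lt.
  have : (t%:R * u) ^+ 2 < 4 / 9 by rewrite expr2; have := mulr_gt0 T0 u0; nra.
  have -> : (t%:R * u) ^+ 2 = t%:R * (u ^+ 2 * (5 / 2 * t%:R)) * (2 / 5) by field.
  by rewrite ua; lra.
set b := 1 + _; have b0 : 0 <= b by rewrite addr_ge0 // divr_ge0 // ltW.
have b1 : b <= 1 + u.
  by rewrite /b lerD2l ler_pdivrMr //; nra.
have b2 : b * (3 + 2 * u) <= 4 + 2 * u by exact: rate_le (ltW u0) t2.
rewrite exprSr [X in _ <= X]mulrAC ler_pdivlMr // -mulrA [X in _ <= X]mulrC.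
apply: ler_pM => //; rewrite ?exprn_ge0 ?mulr_ge0 ?(ltW v0) //; last by lra.
by apply: lerXn2r; rewrite ?nnegrE //; lra.
Qed.

Lemma good_rate_r4 t u : (2 <= t)%N -> 0 < u -> u ^+ 3 * (5 / 2 * t%:R) = 1 ->
  good_rate 4 t u (1 + 2 / (t%:R * (3 + 2 * u))).
Proof.
move=> t2 u0 ua; apply: (good_rate_large (c := 5 / 2)) ; rewrite ?(ltW u0) //; first by lia.
have T2 : 2 <= t%:R :> R by rewrite ler_nat.
have T0 : 0 < t%:R :> R by lra.
have v0 : 0 < 3 + 2 * u by lra.
have Tv0 : 0 < t%:R * (3 + 2 * u) by rewrite mulr_gt0.
have u1 : u <= 1.
  rewrite leNgt; apply/negP => lt.
  have : 1 < u ^+ 3 by rewrite exprn_egt1.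
  by move: ua; move: (u ^+ 3) => z; nra.
have tu : 1 <= t%:R * u.
  rewrite leNgt; apply/negP => lt.
  have : (t%:R * u) ^+ 3 < 1 by rewrite exprn_ilt1 // mulr_ge0 // ltW.
  have -> : (t%:R * u) ^+ 3 = t%:R ^+ 2 * (u ^+ 3 * (5 / 2 * t%:R)) * (2 / 5) by field.
  by rewrite ua expr2; nra.
set b := 1 + _; have b0 : 0 <= b by rewrite addr_ge0 // divr_ge0 // ltW.
have b1 : b <= 1 + 2 / 3 * u.
  by rewrite /b lerD2l ler_pdivrMr //; nra.
have b2 : b * (3 + 2 * u) <= 4 + 2 * u by exact: rate_le (ltW u0) t2.
rewrite exprSr [X in _ <= X]mulrAC ler_pdivlMr // -mulrA.
apply: le_trans (_ : b ^+ 3 * (4 + 2 * u) <= _).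
  by rewrite ler_wpM2l ?exprn_ge0.
have : b ^+ 2 <= (1 + u) ^+ 2 by apply: lerXn2r; rewrite ?nnegrE //; lra.
rewrite [b ^+ 3]exprSr [(1 + u) ^+ 3]exprSr => le2.
apply: le_trans (_ : (1 + u) ^+ 2 * (1 + 2 / 3 * u) * (4 + 2 * u) <= _).
  by rewrite ler_wpM2r ?ler_pM ?exprn_ge0 //; lra.
(* What remains is (1 + 2u/3) (4 + 2u) <= 5 (1 + u), an equality at u = 1. *)
rewrite [X in _ <= X]mulrCA -mulrA ler_wpM2l ?exprn_ge0 //; first by lra.
by nra.
Qed.

(** For u = 2/3 and b = 8/5 the hypothesis of [step_bound] fails. The exact quotient of the
    binomials keeps the factor m / (m + s - 2) that is given away there. *)
Lemma step_r3 m s : (2 <= s)%N -> (0 < m)%N -> s%:R <= 2 / 3 * m%:R :> R ->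
  (8 / 5) ^+ 3 * ('C(m + s - 3, s - 2))%:R <= (8 / 5 - 1) * ('C(m + s, s))%:R :> R.
Proof.
case: s => [|[|s]] //; case: m => // m _ _ sum.
have -> : (m.+1 + s.+2 - 3 = m + s)%N by lia.
have -> : (s.+2 - 2 = s)%N by lia.
have E1 : ((m + s).+1 * 'C(m + s, s) = m.+1 * 'C((m + s).+1, s))%N.
  by have := mul_bin_down (m + s).+1 s; rewrite -pred_Sn => ->; congr (_ * _)%N; lia.
have E2 := mul_bin_diag (m + s).+2 s; have E3 := mul_bin_diag (m + s).+3 s.+1.
rewrite -!pred_Sn in E2 E3; have -> : (m.+1 + s.+2 = (m + s).+3)%N by lia.
set X0 := 'C(m + s, s) in E1 *; set X3 := 'C(_.+3, _) in E3 *.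
have /(congr1 (fun k => k%:R : R)) E :
    ((m + s).+3 * (m + s).+2 * (m + s).+1 * X0 = m.+1 * s.+1 * s.+2 * X3)%N.
  by rewrite -mulnA E1 mulnACA E2 [((m + s).+3 * _)%N]mulnC mulnACA E3 mulnA.
rewrite !natrM -!natr1 natrD in E.
rewrite -[s.+2%:R]natr1 -[s.+1%:R]natr1 -[m.+1%:R]natr1 in sum.
move: E sum.
have : 0 <= X0%:R :> R by []. have : 0 <= X3%:R :> R by [].
have : 0 <= m%:R :> R by []. have : 0 <= s%:R :> R by [].
move: X0%:R X3%:R m%:R s%:R => x0 x3 M S {E1 E2 E3} S0 M0 x30 x00 E H.
(* [d] is the slack in the constraint; in S, d >= 0 the claim is a polynomial inequality. *)
have [d d0 Ed] : exists2 d, 0 <= d & M = 3 / 2 * S + 2 + d.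
  by exists (M - (3 / 2 * S + 2)); lra.
have N0 : 0 < (M + S + 1 + 1 + 1) * (M + S + 1 + 1) * (M + S + 1).
  by rewrite !mulr_gt0 //; lra.
rewrite -(ler_pM2l N0) mulrCA E mulrCA [X in _ <= X]mulrCA !mulrA ler_wpM2r //.
have := (mulr_ge0 S0 d0); have := mulr_ge0 S0 S0; have := mulr_ge0 d0 d0.
rewrite Ed; have := mulr_ge0 S0 (mulr_ge0 S0 S0).
have := mulr_ge0 S0 (mulr_ge0 S0 d0); have := mulr_ge0 S0 (mulr_ge0 d0 d0).
have := mulr_ge0 d0 (mulr_ge0 d0 d0).
nra.
Qed.

End Rates.

(** * The threshold *)

Lemma star_bound_good (R : realFieldType) (r t m s : nat) (u b : R) :
    (2 < r)%N -> (0 < t)%N -> 0 <= u -> u <= 1 -> s%:R <= u * m%:R ->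
    good_rate r t u b ->
  star_bound (t + (m + s))%N (t + s)%N r t.
Proof.
move=> r3 t0 u0 u1 sum [b1 Hb bt].
case: s => [|s] in sum *; first by rewrite !addn0; apply: star_bound_diag.
apply: (star_bound_rate (u := u) (b := b)) => //.
- move=> m' s'; apply: step_bound => //; first exact: ltnW.
  exact: le_trans b1.
have M0 : 0 <= m%:R :> R by [].
apply: le_trans (_ : (b ^+ t - 1) * ((1 + u) * m%:R) <= _).
  by rewrite ler_wpM2l ?subr_ge0 ?exprn_ege1 // natrD; lra.
by rewrite mulrA ler_piMl.
Qed.

Lemma star_bound_one_three (R : realFieldType) (m s : nat) :
    s%:R <= 2 / 3 * m%:R :> R -> star_bound (1 + (m + s))%N (1 + s)%N 3 1.
Proof.
move=> sum; case: s => [|s] in sum *; first by rewrite !addn0; apply: star_bound_diag.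
(* 8/5 = 1 + 1 / (1 + 2/3) is the largest [b] that s <= 2m/3 allows in (b - 1) (m + s) <= m. *)
apply: (star_bound_rate (u := 2 / 3 : R) (b := 8 / 5)) => //; [lra|lra| |].
  by move=> m' s' s2 m0 sum'; apply: step_r3.
by rewrite expr1 natrD; move: sum; lra.
Qed.

Lemma star_bound_large (R : realFieldType) (r t m s : nat) (u : R) :
    (5 <= r)%N -> (0 < t)%N -> 0 < u -> u ^+ r.-1 * (2 * t%:R) = 1 ->
    s%:R <= u * m%:R ->
  star_bound (t + (m + s))%N (t + s)%N r t.
Proof.
case: r => // a r5 t0 u0 ua sum; rewrite [a.+1.-1]/= in ua.
have T1 : 1 <= t%:R :> R by rewrite ler1n.
have u1 : u <= 1.
  rewrite leNgt; apply/negP => lt.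
  have : 1 < u ^+ a by rewrite exprn_egt1 //; lia.
  by move: ua; move: (u ^+ a) => z; nra.
have r3 : (2 < a.+1)%N by lia.
have [t2|t1] := leqP 2 t.
  by apply: star_bound_good sum (good_rate_r5 _ t2 u0 ua) => //; rewrite ltW.
have -> : t = 1%N by lia.
(* On u <= 1 the ratio u (2 + u) / (1 + u)^2 is at most 3/4, its value at 1, and 3 (3/4)^4 =
   243/256. *)
apply: star_bound_good sum (good_rate_one (g := 3 / 4) _ _ _ _) => //; rewrite ?(ltW u0) //.
  by rewrite expr2; nra.
have -> : a = (4 + (a - 4))%N by rewrite subnKC.
by rewrite exprD mulrAC; apply: mulr_ile1; rewrite ?exprn_ge0 ?exprn_ile1 //; lra.
Qed.

Lemma star_bound_34 (R : realFieldType) (r t m s : nat) (u : R) :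
    r = 3%N \/ r = 4%N -> (0 < t)%N -> 0 < u -> u ^+ r.-1 * (5 / 2 * t%:R) = 1 ->
    s%:R <= u * m%:R ->
  star_bound (t + (m + s))%N (t + s)%N r t.
Proof.
move=> rE t0 u0 ua sum; have T1 : 1 <= t%:R :> R by rewrite ler1n.
have u1 : u <= 1.
  rewrite leNgt; apply/negP => lt.
  have : 1 < u ^+ r.-1 by rewrite exprn_egt1 //; case: rE => ->.
  by move: ua; move: (u ^+ _) => z; nra.
have [t2|t1] := leqP 2 t.
  case: rE ua => -> ua.
    by apply: star_bound_good sum (good_rate_r3 t2 u0 ua) => //; rewrite ltW.
  by apply: star_bound_good sum (good_rate_r4 t2 u0 ua) => //; rewrite ltW.
have tE : t = 1%N by lia.
rewrite tE in ua *; case: rE ua => -> /= ua.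
  apply: (@star_bound_one_three R); apply: le_trans sum _.
  rewrite ler_wpM2r // leNgt; apply/negP => lt.
  by move: ua; rewrite expr2; nra.
(* (3/4)^3 = 27/64 exceeds u^3 = 2/5; the constant 33/49 below is u (2 + u) / (1 + u)^2 at u =
   3/4. *)
have u34 : u <= 3 / 4.
  rewrite leNgt; apply/negP => lt.
  have : (3 / 4) ^+ 3 < u ^+ 3 by rewrite ltrXn2r.
  by move: ua; move: (u ^+ 3) => z; lra.
apply: star_bound_good sum (good_rate_one (g := 33 / 49) _ _ _ _) => //; rewrite ?(ltW u0) //.
  by rewrite expr2; nra.
by lra.
Qed.

Lemma threshold_ratio (R : realType) (c : R) (k r t n : nat) :
    (1 < r)%N -> 0 < c * t%:R -> (t <= k)%N -> threshold c k r t <= n%:R ->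
  exists m s : nat, exists2 u : R,
    [/\ k = (t + s)%N, n = (t + (m + s))%N & 0 < u] &
    u ^+ r.-1 * (c * t%:R) = 1 /\ s%:R <= u * m%:R.
Proof.
rewrite /threshold => r1 ct0 le_tk; set P := _ `^ _ => Hn.
have P0 : 0 < P by rewrite powR_gt0.
have r0 : r%:R - 1 = r.-1%:R :> R by rewrite -subn1 natrB // ltnW.
have rn0 : r.-1%:R != 0 :> R by rewrite pnatr_eq0; lia.
have EP : P ^+ r.-1 = c * t%:R.
  rewrite -powR_mulrn ?powR_ge0 // /P -powRrM r0 div1r mulVf // powRr1 //.
  exact: ltW.
have le_kn : (k <= n)%N.
  rewrite -(ler_nat R); apply: le_trans Hn; rewrite lerDr mulr_ge0 ?powR_ge0 //.
  by rewrite subr_ge0 ler_nat.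
exists (n - k)%N, (k - t)%N, P^-1; first by split; rewrite ?invr_gt0 //; lia.
split; first by rewrite exprVn EP mulVf // gt_eqF.
by rewrite mulrC ler_pdivlMr // !natrB // mulrC lerBrDr.
Qed.

(** Every natural number above [x] is an admissible start, and one exists by the Archimedean
    property. The least admissible start is therefore defined and lies below all of them. *)
Lemma n0_at_most_intro (R : realType) (k r t : nat) (x : R) :
    (forall n : nat, x <= n%:R -> star_bound n k r t) -> n0_at_most k r t x.
Proof.
move=> H; have from n : x <= n%:R -> star_bound_from k r t n.
  by move=> xn n' nn'; apply: H; apply: le_trans xn _; rewrite ler_nat.
have ex : exists m, `[< star_bound_from k r t m >].
  exists (Num.bound `|x|); apply/asboolP/from.
  by apply: le_trans (ler_norm x) (ltW (archi_boundP _)).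
case: (ex_minnP ex) => m /asboolP Hm min_m; exists m; split.
  by split=> // m' Hm'; apply: min_m; apply/asboolP.
by move=> n /from Hn; apply: min_m; apply/asboolP.
Qed.

Theorem theorem1p3 (R : realType) (r k t : nat)
    (hr : (3 <= r)%N) (hk : (1 <= k)%N) (ht : (1 <= t)%N) :
  (r = 3%N \/ r = 4%N ->
     n0_at_most k r t (threshold (5 / 2 : R) k r t) /\
     forall n : nat, threshold (5 / 2 : R) k r t <= n%:R ->
       star_bound n k r t) /\
  ((5 <= r)%N ->
     n0_at_most k r t (threshold (2 : R) k r t) /\
     forall n : nat, threshold (2 : R) k r t <= n%:R ->
       star_bound n k r t).
Proof.
suff bound c : 0 < c -> (forall m s u, 0 < u -> u ^+ r.-1 * (c * t%:R) = 1 ->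
    s%:R <= u * m%:R -> star_bound (t + (m + s))%N (t + s)%N r t) ->
    forall n : nat, threshold (c : R) k r t <= n%:R -> star_bound n k r t.
  have both c : 0 < c -> (forall m s u, 0 < u -> u ^+ r.-1 * (c * t%:R) = 1 ->
      s%:R <= u * m%:R -> star_bound (t + (m + s))%N (t + s)%N r t) ->
      n0_at_most k r t (threshold c k r t) /\
      forall n : nat, threshold (c : R) k r t <= n%:R -> star_bound n k r t.
    by move=> c0 /(bound c c0) B; split; first exact: n0_at_most_intro.
  split=> rE; apply: both => // m s u; first exact: star_bound_34.
  exact: star_bound_large.
move=> c0 Hc n Hn; have [ltkt|le_tk] := ltnP k t.
  by apply: star_bound_small => //; apply: leq_trans hr.
have ct0 : 0 < c * t%:R by rewrite mulr_gt0 // ltr0n.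
have [m [s [u [-> -> u0] [ua sum]]]] := threshold_ratio (ltnW hr) ct0 le_tk Hn.
exact: Hc u0 ua sum.
Qed.
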